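(* Let $\alpha: I\to\mathbb{R}^3$ be a space curve parametrized by arc-length $s$, with nowhere vanishing curvature, unit tangent vector $T$ and unit binormal vector $B$, whose binormal indicatrix is a regular curve. Let $\sigma=\int_0^s\|B'(s)\|\,ds$ be the arc-length parameter of the binormal indicatrix of $\alpha$, and regard $T$ and $B$ as functions of $\sigma$. Let $a,\theta$ be constant real numbers (with $\cot\theta$ defined), let $c\in\mathbb{R}^3$ be a constant vector, and let $\sigma_0$ be a fixed parameter value. Then $$\tilde\gamma_B(\sigma)=a\int_{\sigma_0}^{\sigma}B(\sigma)\,d\sigma+a\cot\theta\int_{\sigma_0}^{\sigma}T(\sigma)\,d\sigma+c$$ is a Bertrand curve.
   Context: For a unit speed curve $\alpha$ in $\mathbb{R}^3$: $T=\alpha'$, the curvature is $\kappa=\|\alpha''\|$, and where $\kappa\neq0$ the unit principal normal $N$ is defined by $\alpha''=\kappa N$ and the unit binormal is $B=T\times N$. The torsion $\tau$ is defined by the Frenet-Serret formulae $T'=\kappa N$, $N'=-\kappa T+\tau B$, $B'=-\tau N$. The binormal indicatrix $(B)$ is the curve on the unit sphere $\mathbb{S}^2$ traced by $B(s)$. Convention: curves are regular and, wherever the Frenet frame is used, have nowhere vanishing curvature; this applies also to the curve $\tilde\gamma_B$ (i.e. $a,\theta$ are such that it is a regular curve with nonvanishing curvature). A Bertrand curve is a curve in $\mathbb{R}^3$ which shares its principal normals with another curve (its Bertrand mate). The characterization used in the paper: a curve with curvature $\kappa$ and torsion $\tau$ is a Bertrand curve if and only if there exist non-zero real numbers $A,B$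 such that $A\kappa+B\tau=1$ at every parameter value.
   Formalization: The Bertrand mate is required to be regular only where the torsion of the constructed curve is nonzero; where that torsion vanishes it may be singular, keeping a differentiable unit tangent field. With an everywhere regular mate the claim fails if the torsion vanishes somewhere but not identically. *)

(* Defs.v *)
(* Stdlib reals with Coquelicot. *)
From Stdlib Require Export Reals.
From Coquelicot Require Export Coquelicot.
Open Scope R_scope.

(* Sums and scalar multiples in R^3 are Coquelicot's [plus] and [scal] on the
   product module; Coquelicot has no complete product module, so derivatives
   and integrals of R^3-valued functions are written out componentwise. *)
Notation R3 := (R * R * R)%type.

Definition c1 (v : R3) : R := fst (fst v).
Definition c2 (v : R3) : R := snd (fst v).
Definition c3 (v : R3) : R := snd v.

Definition dot (u v : R3) : R := c1 u * c1 v + c2 u * c2 v + c3 u * c3 v.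

Definition norm3 (v : R3) : R := sqrt (dot v v).

Definition cross (u v : R3) : R3 :=
  (c2 u * c3 v - c3 u * c2 v,
   c3 u * c1 v - c1 u * c3 v,
   c1 u * c2 v - c2 u * c1 v).

Definition normalize (v : R3) : R3 := scal (/ norm3 v) v.

Definition vdiff (g : R -> R3) (s : R) : Prop :=
  ex_derive (fun t => c1 (g t)) s /\
  ex_derive (fun t => c2 (g t)) s /\
  ex_derive (fun t => c3 (g t)) s.

Definition D (g : R -> R3) (s : R) : R3 :=
  (Derive (fun t => c1 (g t)) s,
   Derive (fun t => c2 (g t)) s,
   Derive (fun t => c3 (g t)) s).

Definition vint (g : R -> R3) (a b : R) : R3 :=
  (RInt (fun t => c1 (g t)) a b,
   RInt (fun t => c2 (g t)) a b,
   RInt (fun t => c3 (g t)) a b).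

Definition open_interval (I : R -> Prop) : Prop :=
  open I /\ forall x y z : R, I x -> I y -> x <= z <= y -> I z.

Definition Cn_fun (n : nat) (I : R -> Prop) (f : R -> R) : Prop :=
  forall (k : nat) (s : R), (k <= n)%nat -> I s ->
    ex_derive_n f k s /\ continuous (Derive_n f k) s.

Definition Cn_curve (n : nat) (I : R -> Prop) (g : R -> R3) : Prop :=
  Cn_fun n I (fun t => c1 (g t)) /\
  Cn_fun n I (fun t => c2 (g t)) /\
  Cn_fun n I (fun t => c3 (g t)).

Definition regular_curve (I : R -> Prop) (g : R -> R3) : Prop :=
  forall s : R, I s -> vdiff g s /\ D g s <> zero.

Definition unit_speed (I : R -> Prop) (g : R -> R3) : Prop :=
  forall s : R, I s -> norm3 (D g s) = 1.

(* Frenet apparatus of a regular curve in an arbitrary regular parameter: the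
   division by the speed turns derivatives into derivatives with respect to arc
   length.  For a unit speed curve, T = g', kappa = |g''| and g'' = kappa N. *)
Definition tangent (g : R -> R3) (s : R) : R3 := normalize (D g s).

Definition normal (g : R -> R3) (s : R) : R3 := normalize (D (tangent g) s).

Definition binormal (g : R -> R3) (s : R) : R3 :=
  cross (tangent g s) (normal g s).

Definition curvature (g : R -> R3) (s : R) : R :=
  norm3 (D (tangent g) s) / norm3 (D g s).

(* The B-component of N', i.e. the sign convention N' = - kappa T + tau B. *)
Definition torsion (g : R -> R3) (s : R) : R :=
  dot (D (normal g) s) (binormal g s) / norm3 (D g s).

Definition frenet_curve (I : R -> Prop) (g : R -> R3) : Prop :=
  regular_curve I g /\
  forall s : R, I s ->
    vdiff (tangent g) s /\ curvature g s <> 0 /\ vdiff (normal g) s.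

(* Arc length of the binormal indicatrix, measured from s = 0. *)
Definition binormal_arclength (g : R -> R3) (s : R) : R :=
  RInt (fun u => norm3 (D (binormal g) u)) 0 s.

Definition image (f : R -> R) (I : R -> Prop) (y : R) : Prop :=
  exists s : R, I s /\ y = f s.

Definition line (p d : R3) (x : R3) : Prop :=
  exists r : R, x = plus p (scal r d).

(* [t] is a differentiable field of unit tangents along [b].  Where b' <> 0 it
   is + or - the unit tangent of [b], so that the line through [b s] directed by
   [D t s] is then the usual principal normal line of [b]; [D t s <> zero] is the
   nonvanishing of the curvature of [b].  Points with b' = 0 are allowed. *)
Definition unit_tangent_field (I : R -> Prop) (b t : R -> R3) : Prop :=
  forall s : R, I s ->
    vdiff b s /\ vdiff t s /\ norm3 (t s) = 1 /\
    exists v : R, D b s = scal v (t s).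

(* [b] shares its principal normal lines with [g].  Both curves use the same
   parameter, which is the correspondence between their points. *)
Definition bertrand_mate (I : R -> Prop) (g b : R -> R3) : Prop :=
  exists t : R -> R3,
    unit_tangent_field I b t /\
    forall s : R, I s ->
      D t s <> zero /\
      (forall x : R3,
          line (b s) (D t s) x <-> line (g s) (normal g s) x).

(* The mate is required to be regular wherever the torsion of [g] is nonzero.
   If the torsion of [g] vanishes nowhere, this is the usual notion, with a
   regular mate of nonvanishing curvature.  Nothing more can be asked where the
   torsion is zero: a mate has the form g + l N with l a constant, and when g is
   not planar its derivative necessarily vanishes at each zero of the torsion
   (there, the mate passes through the centre of curvature of g). *)
Definition bertrand_curve (I : R -> Prop) (g : R -> R3) : Prop :=
  frenet_curve I g /\
  exists b : R -> R3,
    (exists s : R, I s /\ b s <> g s) /\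
    bertrand_mate I g b /\
    forall s : R, I s -> torsion g s <> 0 -> D b s <> zero.

(* [sinv] expresses the parameter s of [al] as a function of sigma. *)
Definition gamma_B (al : R -> R3) (sinv : R -> R) (a theta sigma0 : R) (c : R3)
    (sigma : R) : R3 :=
  plus
    (plus
      (scal a (vint (fun x => binormal al (sinv x)) sigma0 sigma))
      (scal (a * (cos theta / sin theta))
            (vint (fun x => tangent al (sinv x)) sigma0 sigma)))
    c.

(* Main.v *)
(* With respect to sigma the frame of [al] satisfies T' = rho N,
   N' = - rho T + e B, B' = - e N, where rho = kappa / |tau| and e = tau / |tau|
   is locally constant; so gamma' = a B + a cot(theta) T has constant length and
   the principal normal of gamma is + or - N.  The mate is b = gamma - a e N:
   the B-components cancel in b', which leaves b' = a e (rho + e cot(theta)) T.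
   Hence T is a unit tangent field of b, whose derivative rho N never vanishes,
   and rho + e cot(theta) is, up to a nonzero factor, the torsion of gamma. *)
Require Import Defs.
From Stdlib Require Import Lra Ranalysis5.

(** [D] is total and says nothing about differentiability. The relational form carries existence and
    value together, so derivatives can be computed and proved to exist in one pass. *)
Definition is_vderive (g : R -> R3) (s : R) (l : R3) : Prop :=
  is_derive (fun t => c1 (g t)) s (c1 l) /\
  is_derive (fun t => c2 (g t)) s (c2 l) /\
  is_derive (fun t => c3 (g t)) s (c3 l).

Definition vcontinuous (g : R -> R3) (s : R) : Prop :=
  continuous (fun t => c1 (g t)) s /\
  continuous (fun t => c2 (g t)) s /\
  continuous (fun t => c3 (g t)) s.

Ltac split3 := split; [|split].

(** * Coordinates, inner product and norm in R^3 *)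

Lemma R3_ext (u v : R3) : c1 u = c1 v -> c2 u = c2 v -> c3 u = c3 v -> u = v.
Proof.
  destruct u as [[u1 u2] u3], v as [[v1 v2] v3]; unfold c1, c2, c3; simpl.
  congruence.
Qed.

Lemma c1_plus (u v : R3) : c1 (plus u v) = c1 u + c1 v. Proof. reflexivity. Qed.
Lemma c2_plus (u v : R3) : c2 (plus u v) = c2 u + c2 v. Proof. reflexivity. Qed.
Lemma c3_plus (u v : R3) : c3 (plus u v) = c3 u + c3 v. Proof. reflexivity. Qed.
Lemma c1_scal (k : R) (v : R3) : c1 (scal k v) = k * c1 v. Proof. reflexivity. Qed.
Lemma c2_scal (k : R) (v : R3) : c2 (scal k v) = k * c2 v. Proof. reflexivity. Qed.
Lemma c3_scal (k : R) (v : R3) : c3 (scal k v) = k * c3 v. Proof. reflexivity. Qed.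
Lemma c1_cross (u v : R3) : c1 (cross u v) = c2 u * c3 v - c3 u * c2 v.
Proof. reflexivity. Qed.
Lemma c2_cross (u v : R3) : c2 (cross u v) = c3 u * c1 v - c1 u * c3 v.
Proof. reflexivity. Qed.
Lemma c3_cross (u v : R3) : c3 (cross u v) = c1 u * c2 v - c2 u * c1 v.
Proof. reflexivity. Qed.
Lemma c1_zero : c1 zero = 0. Proof. reflexivity. Qed.
Lemma c2_zero : c2 zero = 0. Proof. reflexivity. Qed.
Lemma c3_zero : c3 zero = 0. Proof. reflexivity. Qed.

Hint Rewrite c1_plus c2_plus c3_plus c1_scal c2_scal c3_scal
  c1_cross c2_cross c3_cross c1_zero c2_zero c3_zero : coords.

Ltac coords := unfold dot; autorewrite with coords.

Lemma dot_comm (u v : R3) : dot u v = dot v u.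
Proof. coords; ring. Qed.
Lemma dot_plus_l (u v w : R3) : dot (plus u v) w = dot u w + dot v w.
Proof. coords; ring. Qed.
Lemma dot_scal_l (k : R) (u v : R3) : dot (scal k u) v = k * dot u v.
Proof. coords; ring. Qed.
Lemma dot_plus_r (u v w : R3) : dot w (plus u v) = dot w u + dot w v.
Proof. coords; ring. Qed.
Lemma dot_scal_r (k : R) (u v : R3) : dot v (scal k u) = k * dot v u.
Proof. coords; ring. Qed.

Lemma dot_self_ge0 (v : R3) : 0 <= dot v v.
Proof. unfold dot; nra. Qed.

Lemma norm3_sqr (v : R3) : norm3 v * norm3 v = dot v v.
Proof. apply sqrt_sqrt, dot_self_ge0. Qed.

Lemma norm3_ge0 (v : R3) : 0 <= norm3 v.
Proof. apply sqrt_pos. Qed.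

Lemma norm3_scal (k : R) (v : R3) : norm3 (scal k v) = Rabs k * norm3 v.
Proof.
  unfold norm3; rewrite dot_scal_l, dot_scal_r, <- Rmult_assoc.
  rewrite sqrt_mult; [|nra|apply dot_self_ge0].
  now fold (Rsqr k); rewrite sqrt_Rsqr_abs.
Qed.

Lemma norm3_unit (v : R3) : norm3 v = 1 <-> dot v v = 1.
Proof.
  split; intros h.
  - rewrite <- norm3_sqr, h; ring.
  - unfold norm3; rewrite h; apply sqrt_1.
Qed.

Lemma normalize_unit (v : R3) : norm3 v = 1 -> normalize v = v.
Proof. intros h; unfold normalize; rewrite h; apply R3_ext; coords; field. Qed.

Lemma dot_normalize (v : R3) : norm3 v <> 0 -> dot (normalize v) (normalize v) = 1.
Proof.
  intros h; unfold normalize.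
  rewrite dot_scal_l, dot_scal_r, <- norm3_sqr; field; exact h.
Qed.

(** * Orthonormal pairs and their cross product *)

Definition orthonormal_pair (u v : R3) : Prop :=
  dot u u = 1 /\ dot v v = 1 /\ dot u v = 0.

(** Special case of the triple product formula (u x v) x u = (u.u) v - (u.v) u. *)
Lemma cross_cross_l (u v : R3) :
  orthonormal_pair u v -> cross (cross u v) u = v.
Proof.
  intros [hu [hv huv]].
  assert (h : cross (cross u v) u = plus (scal (dot u u) v) (scal (- dot u v) u))
    by (apply R3_ext; coords; ring).
  rewrite h, hu, huv; apply R3_ext; coords; ring.
Qed.

Lemma cross_cross_r (u v : R3) :
  orthonormal_pair u v -> cross (cross u v) v = scal (-1) u.
Proof.
  intros [hu [hv huv]].
  assert (h : cross (cross u v) v = plus (scal (dot u v) v) (scal (- dot v v) u))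
    by (apply R3_ext; coords; ring).
  rewrite h, hv, huv; apply R3_ext; coords; ring.
Qed.

Lemma cross_anticomm (u v : R3) : cross u v = scal (-1) (cross v u).
Proof. apply R3_ext; coords; ring. Qed.

Lemma dot_cross_l (u v : R3) : dot u (cross u v) = 0.
Proof. coords; ring. Qed.

Lemma dot_cross_self (u v : R3) :
  orthonormal_pair u v -> dot (cross u v) (cross u v) = 1.
Proof.
  intros [hu [hv huv]].
  assert (h : dot (cross u v) (cross u v) = dot u u * dot v v - dot u v * dot u v)
    by (coords; ring).
  rewrite h, hu, hv, huv; ring.
Qed.

(** Cramer's rule: for arbitrary u and v, w multiplied by the Gram determinant of u and v is a
    polynomial identity in coordinates. Orthonormality makes that determinant 1. *)
Lemma orthonormal_expansion (u v w : R3) :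
  orthonormal_pair u v ->
  w = plus (plus (scal (dot w u) u) (scal (dot w v) v))
        (scal (dot w (cross u v)) (cross u v)).
Proof.
  intros [hu [hv huv]].
  assert (h : scal (dot u u * dot v v - dot u v * dot u v) w =
    plus (plus
      (scal (dot w u) (plus (scal (dot v v) u) (scal (- dot u v) v)))
      (scal (dot w v) (plus (scal (dot u u) v) (scal (- dot u v) u))))
      (scal (dot w (cross u v)) (cross u v))) by (apply R3_ext; coords; ring).
  rewrite hu, hv, huv in h.
  (* The factor has the shape that the Gram determinant takes in [h] after the rewriting. *)
  transitivity (scal (1 * 1 - 0 * 0) w); [apply R3_ext; coords; ring|].
  rewrite h; apply R3_ext; coords; ring.
Qed.

(** * Differentiation and continuity of vector functions *)

Lemma is_derive_eq (f : R -> R) (x l m : R) : is_derive f x l -> l = m -> is_derive f x m.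
Proof. now intros h <-. Qed.

Lemma is_derive_Rmult (f g : R -> R) (x l m : R) :
  is_derive f x l -> is_derive g x m ->
  is_derive (fun t => f t * g t) x (l * g x + f x * m).
Proof. intros hf hg; apply (is_derive_mult f g x l m hf hg Rmult_comm). Qed.

Lemma is_derive_Rplus (f g : R -> R) (x l m : R) :
  is_derive f x l -> is_derive g x m -> is_derive (fun t => f t + g t) x (l + m).
Proof. intros hf hg; apply (is_derive_plus f g x l m hf hg). Qed.

Lemma is_derive_Rminus (f g : R -> R) (x l m : R) :
  is_derive f x l -> is_derive g x m -> is_derive (fun t => f t - g t) x (l - m).
Proof. intros hf hg; apply (is_derive_minus f g x l m hf hg). Qed.

Lemma is_vderive_eq (g : R -> R3) (s : R) (l m : R3) :
  is_vderive g s l -> l = m -> is_vderive g s m.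
Proof. now intros h <-. Qed.

Lemma is_vderive_D (g : R -> R3) (s : R) (l : R3) : is_vderive g s l -> D g s = l.
Proof.
  intros [h1 [h2 h3]].
  now apply R3_ext; apply is_derive_unique.
Qed.

Lemma vdiff_is_vderive (g : R -> R3) (s : R) : vdiff g s -> is_vderive g s (D g s).
Proof. now intros [h1 [h2 h3]]; split3; apply Derive_correct. Qed.

Lemma is_vderive_vdiff (g : R -> R3) (s : R) (l : R3) : is_vderive g s l -> vdiff g s.
Proof. now intros [h1 [h2 h3]]; split3; eexists; eauto. Qed.

Lemma is_vderive_vcontinuous (g : R -> R3) (s : R) (l : R3) :
  is_vderive g s l -> vcontinuous g s.
Proof.
  intros [h1 [h2 h3]].
  split3; refine (ex_derive_continuous _ s _); eexists; eassumption.
Qed.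

(** Formulas for the Frenet vectors hold only on the parameter interval; since it is open, they can
    still be differentiated at each of its points. *)
Lemma is_vderive_ext_loc (f g : R -> R3) (s : R) (l : R3) :
  locally s (fun t => f t = g t) -> is_vderive f s l -> is_vderive g s l.
Proof.
  intros h [h1 [h2 h3]]; split3;
    (eapply is_derive_ext_loc; [|eassumption]);
    refine (filter_imp _ _ _ h); intros t e; simpl; now rewrite e.
Qed.

Lemma is_vderive_plus (f g : R -> R3) (s : R) (l m : R3) :
  is_vderive f s l -> is_vderive g s m ->
  is_vderive (fun t => plus (f t) (g t)) s (plus l m).
Proof.
  intros [f1 [f2 f3]] [g1 [g2 g3]]; split3; apply is_derive_Rplus; assumption.
Qed.

Lemma is_vderive_scal (f : R -> R) (g : R -> R3) (s l : R) (m : R3) :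
  is_derive f s l -> is_vderive g s m ->
  is_vderive (fun t => scal (f t) (g t)) s (plus (scal l (g s)) (scal (f s) m)).
Proof.
  intros hf [g1 [g2 g3]]; split3; apply is_derive_Rmult; assumption.
Qed.

Lemma is_vderive_scal_const (k : R) (g : R -> R3) (s : R) (m : R3) :
  is_vderive g s m -> is_vderive (fun t => scal k (g t)) s (scal k m).
Proof.
  intros [g1 [g2 g3]]; split3; apply is_derive_scal; assumption.
Qed.

Lemma is_vderive_const (v : R3) (s : R) : is_vderive (fun _ => v) s zero.
Proof. split3; exact (is_derive_const _ s). Qed.

Lemma is_vderive_comp (g : R -> R3) (h : R -> R) (s k : R) (l : R3) :
  is_vderive g (h s) l -> is_derive h s k ->
  is_vderive (fun t => g (h t)) s (scal k l).
Proof.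
  intros [g1 [g2 g3]] hh; split3.
  - exact (is_derive_comp (fun t => c1 (g t)) h s _ _ g1 hh).
  - exact (is_derive_comp (fun t => c2 (g t)) h s _ _ g2 hh).
  - exact (is_derive_comp (fun t => c3 (g t)) h s _ _ g3 hh).
Qed.

Lemma is_derive_dot (f g : R -> R3) (s : R) (l m : R3) :
  is_vderive f s l -> is_vderive g s m ->
  is_derive (fun t => dot (f t) (g t)) s (dot l (g s) + dot (f s) m).
Proof.
  intros [f1 [f2 f3]] [g1 [g2 g3]]; eapply is_derive_eq.
  - apply is_derive_Rplus; [apply is_derive_Rplus|];
      apply is_derive_Rmult; eassumption.
  - coords; ring.
Qed.

Lemma is_vderive_cross (f g : R -> R3) (s : R) (l m : R3) :
  is_vderive f s l -> is_vderive g s m ->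
  is_vderive (fun t => cross (f t) (g t)) s (plus (cross l (g s)) (cross (f s) m)).
Proof.
  intros [f1 [f2 f3]] [g1 [g2 g3]]; split3;
    (eapply is_derive_eq;
      [apply is_derive_Rminus; apply is_derive_Rmult; eassumption|coords; ring]).
Qed.

Lemma continuous_Rmult (f g : R -> R) (x : R) :
  continuous f x -> continuous g x -> continuous (fun t => f t * g t) x.
Proof. intros hf hg; apply (continuous_mult f g x hf hg). Qed.

Lemma continuous_dot (f g : R -> R3) (s : R) :
  vcontinuous f s -> vcontinuous g s -> continuous (fun t => dot (f t) (g t)) s.
Proof.
  intros [f1 [f2 f3]] [g1 [g2 g3]].
  refine (continuous_plus _ _ s _ _); [refine (continuous_plus _ _ s _ _)|];
    now apply continuous_Rmult.
Qed.

Lemma vcontinuous_cross (f g : R -> R3) (s : R) :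
  vcontinuous f s -> vcontinuous g s -> vcontinuous (fun t => cross (f t) (g t)) s.
Proof.
  intros [f1 [f2 f3]] [g1 [g2 g3]].
  split3; refine (continuous_minus _ _ s _ _); now apply continuous_Rmult.
Qed.

Lemma continuous_norm3 (g : R -> R3) (s : R) :
  vcontinuous g s -> continuous (fun t => norm3 (g t)) s.
Proof.
  intros hg; apply (continuous_comp (fun t => dot (g t) (g t)) sqrt).
  - now apply continuous_dot.
  - apply continuous_sqrt.
Qed.

(** The radial coefficient m stays unspecified: the later computation takes a product with a vector
    orthogonal to [g s], which removes it. *)
Lemma is_vderive_normalize (g : R -> R3) (s : R) (l : R3) :
  is_vderive g s l -> norm3 (g s) <> 0 ->
  exists m : R, is_vderive (fun t => normalize (g t)) s
    (plus (scal m (g s)) (scal (/ norm3 (g s)) l)).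
Proof.
  intros hg hn; eexists.
  apply (is_vderive_scal (fun t => / norm3 (g t)) g); [|exact hg].
  apply is_derive_inv; [|exact hn].
  apply is_derive_sqrt; [apply is_derive_dot; exact hg|].
  rewrite <- norm3_sqr; pose proof (norm3_ge0 (g s)); nra.
Qed.

(** * Frenet-Serret formulae for a unit speed curve of class C^3 *)

Lemma is_derive_locally_const (f : R -> R) (x l k : R) :
  locally x (fun t => f t = k) -> is_derive f x l -> l = 0.
Proof.
  intros h hf; rewrite <- (is_derive_unique _ _ _ hf).
  rewrite (Derive_ext_loc _ (fun _ => k) x h); apply Derive_const.
Qed.

(** Differentiating the constant g.g gives 2 l.g = 0. *)
Lemma dot_unit_derive (g : R -> R3) (s : R) (l : R3) :
  locally s (fun t => dot (g t) (g t) = 1) -> is_vderive g s l -> dot l (g s) = 0.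
Proof.
  intros h hg.
  pose proof (is_derive_locally_const _ _ _ _ h (is_derive_dot _ _ _ _ _ hg hg)) as e.
  rewrite (dot_comm (g s) l) in e; lra.
Qed.

(** Existence of the derivative of order k unfolds to differentiability of the one of order k - 1.
    So k = 1, 2, 3 yield the three derivatives, and continuity at k = 3 yields the last clause. *)
Lemma Cn_curve_3 (I : R -> Prop) (g : R -> R3) (s : R) :
  Cn_curve 3 I g -> I s ->
  is_vderive g s (D g s) /\ is_vderive (D g) s (D (D g) s) /\
  is_vderive (D (D g)) s (D (D (D g)) s) /\ vcontinuous (D (D (D g))) s.
Proof.
  intros [h1 [h2 h3]] Is.
  split; [|split; [|split]]; try apply vdiff_is_vderive; split3.
  - apply (h1 1%nat s); auto.
  - apply (h2 1%nat s); auto.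
  - apply (h3 1%nat s); auto.
  - apply (h1 2%nat s); auto.
  - apply (h2 2%nat s); auto.
  - apply (h3 2%nat s); auto.
  - apply (h1 3%nat s); auto.
  - apply (h2 3%nat s); auto.
  - apply (h3 3%nat s); auto.
  - apply (h1 3%nat s); auto.
  - apply (h2 3%nat s); auto.
  - apply (h3 3%nat s); auto.
Qed.

(** N' is found from its projections on the frame. Its B-component is det(T, al'', al''') / kappa^2,
    which shows that the torsion is continuous; this is what later makes its sign locally
    constant. *)
Lemma frenet_serret (I : R -> Prop) (al : R -> R3) (s : R) :
  open I -> Cn_curve 3 I al -> unit_speed I al ->
  (forall t : R, I t -> curvature al t <> 0) -> I s ->
  orthonormal_pair (tangent al s) (normal al s) /\
  is_vderive (tangent al) s (scal (curvature al s) (normal al s)) /\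
  is_vderive (normal al) s
    (plus (scal (- curvature al s) (tangent al s))
          (scal (torsion al s) (binormal al s))) /\
  is_vderive (binormal al) s (scal (- torsion al s) (normal al s)) /\
  0 < curvature al s /\
  continuous (curvature al) s /\ continuous (torsion al) s.
Proof.
  intros Io al3 al1 hk Is.
  set (A3 := D (D (D al))).
  assert (d2 : forall t, I t -> is_vderive (D al) t (D (D al) t)).
  { intros t It; destruct (Cn_curve_3 I al t al3 It) as [_ [h _]]; exact h. }
  assert (d3 : forall t, I t -> is_vderive (D (D al)) t (A3 t)).
  { intros t It; destruct (Cn_curve_3 I al t al3 It) as [_ [_ [h _]]]; exact h. }
  assert (tanE : forall t, I t -> tangent al t = D al t)
    by (intros t It; apply normalize_unit, al1, It).
  assert (dtan : forall t, I t -> is_vderive (tangent al) t (D (D al) t)).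
  { intros t It; apply (is_vderive_ext_loc (D al)).
    - refine (filter_imp _ _ _ (Io t It)); intros u Iu; now rewrite tanE.
    - now apply d2. }
  assert (kapE : forall t, I t -> curvature al t = norm3 (D (D al) t)).
  { intros t It; unfold curvature.
    rewrite (is_vderive_D _ _ _ (dtan t It)), al1 by exact It; field. }
  assert (norE : forall t, I t -> normal al t = normalize (D (D al) t)).
  { intros t It; unfold normal; now rewrite (is_vderive_D _ _ _ (dtan t It)). }
  assert (orth : forall t, I t -> orthonormal_pair (tangent al t) (normal al t)).
  { intros t It; split3.
    - rewrite tanE by exact It; now apply norm3_unit, al1.
    - rewrite norE by exact It; apply dot_normalize.
      rewrite <- kapE by exact It; now apply hk.
    - rewrite norE by exact It; unfold normalize; rewrite dot_scal_r, dot_comm.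
      rewrite (dot_unit_derive (tangent al) t); [ring| |now apply dtan].
      refine (filter_imp _ _ _ (Io t It)); intros u Iu.
      rewrite tanE by exact Iu; now apply norm3_unit, al1. }
  assert (tanK : forall t, I t ->
            is_vderive (tangent al) t (scal (curvature al t) (normal al t))).
  { intros t It; rewrite norE, kapE by exact It.
    replace (scal _ _) with (D (D al) t); [now apply dtan|].
    pose proof (hk t It) as hkt; rewrite kapE in hkt by exact It.
    apply R3_ext; unfold normalize; coords; now field. }
  assert (norD : forall t, I t -> exists v, is_vderive (normal al) t v /\
            v = plus (scal (- curvature al t) (tangent al t))
                     (scal (dot v (binormal al t)) (binormal al t)) /\
            dot v (binormal al t) =
              dot (A3 t) (cross (tangent al t) (D (D al) t))
              * (/ curvature al t * / curvature al t)).
  { intros t It.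
    pose proof (hk t It) as hkt.
    destruct (is_vderive_normalize _ _ _ (d3 t It)) as [m hm];
      [now rewrite <- kapE|].
    assert (hv : is_vderive (normal al) t (plus (scal m (D (D al) t))
      (scal (/ norm3 (D (D al) t)) (A3 t)))).
    { refine (is_vderive_ext_loc _ _ _ _ _ hm).
      refine (filter_imp _ _ _ (Io t It)); intros u Iu; now rewrite norE. }
    eexists; split3; [exact hv| |].
    (* Done while the derivative is still explicit: its multiple of al'' drops out because al'' is
       orthogonal to T x al''. *)
    2:{ unfold binormal; rewrite norE by exact It; unfold normalize.
      rewrite <- kapE by exact It; coords; ring. }
    (* From here only [hv] matters: N.N = 1 and N.T = 0 are differentiated to get the N- and
       T-components of v. *)
    revert hv; generalize (plus (scal m (D (D al) t))
      (scal (/ norm3 (D (D al) t)) (A3 t))); intros v hv.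
    assert (vN : dot v (normal al t) = 0).
    { refine (dot_unit_derive _ _ _ _ hv).
      refine (filter_imp _ _ _ (Io t It)); intros u Iu; apply (orth u Iu). }
    assert (vT : dot v (tangent al t) = - curvature al t).
    { assert (h : locally t (fun u => dot (normal al u) (tangent al u) = 0)).
      { refine (filter_imp _ _ _ (Io t It)); intros u Iu.
        rewrite dot_comm; apply (orth u Iu). }
      pose proof (is_derive_locally_const _ _ _ _ h
        (is_derive_dot _ _ _ _ _ hv (tanK t It))) as e.
      rewrite dot_scal_r in e; destruct (orth t It) as [_ [e1 _]].
      rewrite e1 in e; lra. }
    rewrite (orthonormal_expansion (tangent al t) (normal al t) v (orth t It)) at 1.
    rewrite vN, vT; fold (binormal al t); apply R3_ext; coords; ring. }
  assert (torE : forall t, I t -> torsion al t =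
            dot (A3 t) (cross (tangent al t) (D (D al) t))
              * (/ curvature al t * / curvature al t)).
  { intros t It; destruct (norD t It) as [v [hv [_ e]]]; unfold torsion.
    rewrite (is_vderive_D _ _ _ hv), al1, e by exact It; field; now apply hk. }
  assert (norK : is_vderive (normal al) s
            (plus (scal (- curvature al s) (tangent al s))
                  (scal (torsion al s) (binormal al s)))).
  { destruct (norD s Is) as [v [hv [e1 e2]]].
    rewrite torE, <- e2, <- e1 by exact Is; exact hv. }
  assert (kapC : continuous (curvature al) s).
  { apply (continuous_ext_loc _ (fun t => norm3 (D (D al) t))).
    - refine (filter_imp _ _ _ (Io s Is)); intros u Iu; symmetry; now apply kapE.
    - apply continuous_norm3, (is_vderive_vcontinuous _ _ (A3 s)).
      now apply d3. }
  split; [now apply orth|split; [now apply tanK|split; [exact norK|]]].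
  split; [|split3].
  (* In B' = T' x N + T x N' the terms with N x N and T x T vanish, leaving tau (T x B) = - tau
     N. *)
  - eapply eq_ind; [apply is_vderive_cross; [now apply tanK|exact norK]|].
    transitivity (scal (torsion al s) (cross (tangent al s) (binormal al s)));
      [apply R3_ext; coords; ring|].
    unfold binormal; rewrite cross_anticomm, cross_cross_l by now apply orth.
    apply R3_ext; coords; ring.
  - pose proof (hk s Is) as hks; rewrite kapE in * by exact Is.
    pose proof (norm3_ge0 (D (D al) s)); lra.
  - exact kapC.
  - apply (continuous_ext_loc _ (fun t =>
      dot (A3 t) (cross (tangent al t) (D (D al) t))
        * (/ curvature al t * / curvature al t))).
    + refine (filter_imp _ _ _ (Io s Is)); intros u Iu; symmetry; now apply torE.
    + apply continuous_Rmult.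
      * apply continuous_dot.
        { destruct (Cn_curve_3 I al s al3 Is) as [_ [_ [_ h]]]; exact h. }
        apply vcontinuous_cross; eapply is_vderive_vcontinuous;
          [now apply dtan|now apply d3].
      * apply continuous_Rmult; apply continuous_Rinv_comp;
          try exact kapC; now apply hk.
Qed.

(** * Integrals and monotone functions on an open interval *)

Lemma open_interval_hull (I : R -> Prop) (x y t : R) :
  open_interval I -> I x -> I y -> Rmin x y <= t <= Rmax x y -> I t.
Proof.
  intros [_ hI] Ix Iy ht; destruct (Rle_dec x y) as [h|h].
  - rewrite Rmin_left, Rmax_right in ht by exact h; exact (hI x y t Ix Iy ht).
  - rewrite Rmin_right, Rmax_left in ht by lra; exact (hI y x t Iy Ix ht).
Qed.

Lemma is_derive_RInt_interval (I : R -> Prop) (f : R -> R) (x0 x : R) :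
  open_interval I -> (forall t : R, I t -> continuous f t) -> I x0 -> I x ->
  is_derive (fun t => RInt f x0 t) x (f x).
Proof.
  intros hI hf I0 Ix; apply (is_derive_RInt f _ x0 x); [|now apply hf].
  refine (filter_imp _ _ _ (proj1 hI x Ix)); intros y Iy.
  apply (RInt_correct f), ex_RInt_continuous; intros z hz.
  apply hf, (open_interval_hull I x0 y); assumption.
Qed.

Lemma is_derive_continuity_pt (f : R -> R) (x l : R) :
  is_derive f x l -> continuity_pt f x.
Proof.
  intros h; apply derivable_continuous_pt; exists l; now apply is_derive_Reals.
Qed.

Lemma increasing_of_derive_pos (I : R -> Prop) (F f : R -> R) (x y : R) :
  open_interval I -> (forall t : R, I t -> is_derive F t (f t) /\ 0 < f t) ->
  I x -> I y -> x < y -> F x < F y.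
Proof.
  intros hI hF Ix Iy xy.
  destruct (MVT_gen F x y f) as [t [ht e]].
  - intros t ht; apply hF, (open_interval_hull I x y); auto; lra.
  - intros t ht; apply (is_derive_continuity_pt F t (f t)), hF.
    now apply (open_interval_hull I x y).
  - assert (It : I t) by now apply (open_interval_hull I x y).
    pose proof (proj2 (hF t It)); nra.
Qed.

(** [IVT_interv] asks for strict signs at the endpoints, so a value z attained at an endpoint is
    treated apart. *)
Lemma intermediate_value (F : R -> R) (x y z : R) :
  (forall t : R, x <= t <= y -> continuity_pt F t) -> x <= y ->
  F x <= z <= F y -> exists t : R, x <= t <= y /\ F t = z.
Proof.
  intros hF xy hz.
  destruct (Req_dec (F x) z) as [e1|n1]; [exists x; split; [lra|exact e1]|].
  destruct (Req_dec (F y) z) as [e2|n2]; [exists y; split; [lra|exact e2]|].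
  destruct (Req_dec x y) as [e|n]; [subst; lra|].
  destruct (IVT_interv (fun t => F t - z) x y) as [t [ht e]]; try lra.
  - intros t ht; apply continuity_pt_minus; [now apply hF|].
    apply continuity_pt_const; now intros ? ?.
  - exists t; split; [exact ht|lra].
Qed.

(** * Inverse of a function with positive derivative *)

Section Inverse.

Variables (I : R -> Prop) (F f G : R -> R).
Hypothesis hI : open_interval I.
Hypothesis hF : forall t : R, I t -> is_derive F t (f t) /\ 0 < f t.
Hypothesis hG : forall t : R, I t -> G (F t) = t.

Let image_between (x y z : R) :
  I x -> I y -> x <= y -> F x <= z <= F y ->
  exists t : R, I t /\ x <= t <= y /\ z = F t.
Proof.
  intros Ix Iy xy hz.
  destruct (intermediate_value F x y z) as [t [ht e]]; auto.
  - intros t ht; apply (is_derive_continuity_pt F t (f t)), hF.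
    exact (proj2 hI x y t Ix Iy ht).
  - exists t; split; [exact (proj2 hI x y t Ix Iy ht)|now split].
Qed.

(** F takes values strictly below and above [F s] at s - r and s + r, hence all values in between.
    This gives both the openness of the image and the continuity of the inverse. *)
Lemma image_locally (s : R) (eps : posreal) :
  I s -> locally (F s) (fun z => exists t : R, I t /\ Rabs (t - s) < eps /\ z = F t).
Proof.
  intros Is; destruct (proj1 hI s Is) as [d hd].
  set (r := Rmin d eps / 2).
  assert (hr : 0 < r /\ r < d /\ r < eps).
  { pose proof (cond_pos d); pose proof (cond_pos eps); unfold r.
    pose proof (Rmin_l d eps); pose proof (Rmin_r d eps).
    assert (0 < Rmin d eps) by (apply Rmin_pos; assumption); lra. }
  assert (Il : I (s - r)) by (apply hd; apply Rabs_def1;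
      unfold minus, plus, opp; simpl; lra).
  assert (Ir : I (s + r)) by (apply hd; apply Rabs_def1;
      unfold minus, plus, opp; simpl; lra).
  assert (hl : F (s - r) < F s)
    by (apply (increasing_of_derive_pos I F f); auto; lra).
  assert (hr' : F s < F (s + r))
    by (apply (increasing_of_derive_pos I F f); auto; lra).
  assert (hm : 0 < Rmin (F s - F (s - r)) (F (s + r) - F s))
    by (apply Rmin_pos; lra).
  exists (mkposreal _ hm); intros z hz.
  apply Rabs_def2 in hz; unfold minus, plus, opp in hz; simpl in hz.
  pose proof (Rmin_l (F s - F (s - r)) (F (s + r) - F s)).
  pose proof (Rmin_r (F s - F (s - r)) (F (s + r) - F s)).
  destruct (image_between (s - r) (s + r) z) as [t [It [ht e]]]; auto; try lra.
  exists t; split; [exact It|split; [apply Rabs_def1; lra|exact e]].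
Qed.

Lemma open_interval_image : open_interval (image F I).
Proof.
  split.
  - intros y [s [Is ->]].
    refine (filter_imp _ _ _ (image_locally s (mkposreal 1 Rlt_0_1) Is)).
    intros z [t [It [_ e]]]; now exists t.
  - intros x y z [s [Is ->]] [t [It ->]] hz.
    destruct (Rle_or_lt s t) as [st|ts].
    + destruct (image_between s t z) as [u [Iu [_ e]]]; auto; now exists u.
    + pose proof (increasing_of_derive_pos I F f t s hI hF It Is ts); lra.
Qed.

(** The difference quotient of G at [F s] is 1/q, where q is that of F at s; q is close to [f s]
    because t is close to s. *)
Lemma is_derive_inverse (s : R) : I s -> is_derive G (F s) (/ f s).
Proof.
  intros Is; destruct (hF s Is) as [hd hp].
  apply is_derive_Reals; intros eps heps.
  (* The first bound gives q > f/2, hence q f > f^2/2. With the second, |1/q - 1/f| = |q - f| / (q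
     f) < eps. *)
  assert (heta : 0 < Rmin (f s / 2) (eps * (f s * f s) / 2)).
  { apply Rmin_pos; [lra|]; assert (0 < eps * (f s * f s)); [|lra].
    apply Rmult_lt_0_compat; nra. }
  apply is_derive_Reals in hd; destruct (hd _ heta) as [d hq].
  destruct (image_locally s d Is) as [r hr].
  exists r; intros k hk kr.
  destruct (hr (F s + k)) as [t [It [ht e]]].
  { change (Rabs (F s + k - F s) < r); now replace (F s + k - F s) with k by ring. }
  rewrite e, !hG by assumption.
  assert (hts : t - s <> 0) by (intros h; replace t with s in e by lra; lra).
  specialize (hq (t - s) hts ht).
  replace (s + (t - s)) with t in hq by ring.
  replace (F t - F s) with k in hq by lra.
  set (q := k / (t - s)) in hq.
  replace ((t - s) / k) with (/ q) by (unfold q; field; now split).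
  pose proof (Rmin_l (f s / 2) (eps * (f s * f s) / 2)).
  pose proof (Rmin_r (f s / 2) (eps * (f s * f s) / 2)).
  assert (q2 : f s / 2 < q) by (apply Rabs_def2 in hq; lra).
  replace (/ q - / f s) with ((f s - q) * / (q * f s)) by (field; lra).
  assert (hqf : 0 < q * f s) by nra.
  rewrite Rabs_mult, (Rabs_pos_eq (/ _)) by (left; now apply Rinv_0_lt_compat).
  apply (Rmult_lt_reg_r (q * f s)); [exact hqf|].
  rewrite Rmult_assoc, Rinv_l, Rmult_1_r by lra.
  rewrite Rabs_minus_sym; nra.
Qed.

End Inverse.

(** * The Bertrand property derived from a moving frame *)

Lemma sign_sqr (x : R) : x <> 0 -> x / Rabs x * (x / Rabs x) = 1.
Proof.
  intros hx; pose proof (Rabs_no_R0 x hx).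
  replace (x / Rabs x * (x / Rabs x)) with (x * x / (Rabs x * Rabs x))
    by (field; assumption).
  rewrite <- Rabs_mult, Rabs_pos_eq by nra; field; exact hx.
Qed.

(** Where |f t - f x| < |f x|, the value f t has the sign of f x, so f / |f| is locally constant. *)
Lemma is_derive_sign (f : R -> R) (x : R) :
  continuous f x -> f x <> 0 -> is_derive (fun t => f t / Rabs (f t)) x 0.
Proof.
  intros hf hx.
  refine (is_derive_ext_loc (fun _ => f x / Rabs (f x)) _ x 0 _ (is_derive_const _ x)).
  assert (hp : 0 < Rabs (f x)) by now apply Rabs_pos_lt.
  refine (filter_imp _ _ _
    (proj1 (filterlim_locally f (f x)) hf (mkposreal _ hp))); intros t ht.
  change (Rabs (f t - f x) < Rabs (f x)) in ht; revert ht hp.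
  change (Rabs (f t - f x) < Rabs (f x) -> 0 < Rabs (f x) ->
    @eq R (f x / Rabs (f x)) (f t / Rabs (f t))).
  unfold Rabs; repeat destruct Rcase_abs; intros; try lra; field; lra.
Qed.

(** Separates the geometry from the change of parameter: s plays the role of sigma and k that of
    cot(theta). The locally constant sign e enters through e' = 0 and e^2 = 1. *)
Lemma bertrand_of_frame (J : R -> Prop) (g T N : R -> R3) (rho e : R -> R) (a k : R) :
  open J -> (exists s : R, J s) ->
  (forall s : R, J s ->
    orthonormal_pair (T s) (N s) /\
    is_vderive T s (scal (rho s) (N s)) /\
    is_vderive N s (plus (scal (- rho s) (T s)) (scal (e s) (cross (T s) (N s)))) /\
    is_vderive (fun t => cross (T t) (N t)) s (scal (- e s) (N s))) ->
  (forall s : R, J s -> continuous rho s /\ rho s <> 0) ->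
  (forall s : R, J s -> is_derive e s 0 /\ e s * e s = 1) ->
  (forall s : R, J s ->
    is_vderive g s (plus (scal a (cross (T s) (N s))) (scal (a * k) (T s)))) ->
  regular_curve J g -> (forall s : R, J s -> curvature g s <> 0) ->
  bertrand_curve J g.
Proof.
  intros Jo [s0 Js0] hfr hrho he hg hreg hcurv.
  set (V := fun s => plus (scal a (cross (T s) (N s))) (scal (a * k) (T s))).
  (* The constant speed of g. *)
  set (w := sqrt (a * a + a * k * (a * k))).
  (* With a = 0 the derivative of g would vanish, against regularity at [s0]. *)
  assert (ha : a <> 0).
  { intros ->; apply (proj2 (hreg s0 Js0)).
    rewrite (is_vderive_D _ _ _ (hg s0 Js0)); apply R3_ext; coords; ring. }
  assert (hw : 0 < w) by (apply sqrt_lt_R0; nra).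
  assert (nV : forall s, J s -> norm3 (V s) = w).
  { intros s Js; destruct (hfr s Js) as [o _].
    unfold norm3, w; f_equal; unfold V.
    rewrite !dot_plus_l, !dot_plus_r, !dot_scal_l, !dot_scal_r.
    rewrite (dot_comm (cross _ _) (T s)), dot_cross_l, dot_cross_self by exact o.
    rewrite (proj1 o); ring. }
  assert (gE : forall s, J s -> D g s = V s)
    by (intros s Js; apply is_vderive_D, hg, Js).
  assert (tanE : forall s, J s -> tangent g s = scal (/ w) (V s)).
  { intros s Js; unfold tangent, normalize; now rewrite gE, nV. }
  (* The signed curvature factor: the derivative of the tangent of g is f N. The curvature
     hypothesis makes f nonzero, and its continuity then fixes its sign locally. *)
  set (f := fun s => / w * (a * (k * rho s - e s))).
  assert (dtan : forall s, J s -> is_vderive (tangent g) s (scal (f s) (N s))).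
  { intros s Js; apply (is_vderive_ext_loc (fun t => scal (/ w) (V t))).
    - refine (filter_imp _ _ _ (Jo s Js)); intros t Jt; now rewrite tanE.
    - destruct (hfr s Js) as [_ [dT [_ dB]]].
      pose proof (is_vderive_scal_const (/ w) _ _ _ (is_vderive_plus _ _ _ _ _
        (is_vderive_scal_const a _ _ _ dB)
        (is_vderive_scal_const (a * k) _ _ _ dT))) as h.
      refine (is_vderive_eq _ _ _ _ h _).
      unfold f; apply R3_ext; coords; ring. }
  assert (nN : forall s, J s -> norm3 (N s) = 1)
    by (intros s Js; apply norm3_unit, (hfr s Js)).
  assert (hf : forall s, J s -> f s <> 0).
  { intros s Js hfs; apply (hcurv s Js); unfold curvature.
    rewrite (is_vderive_D _ _ _ (dtan s Js)), norm3_scal, hfs, Rabs_R0.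
    unfold Rdiv; ring. }
  assert (cf : forall s, J s -> continuous f s).
  { intros s Js.
    refine (continuous_scal_r (/ w) (fun t => a * (k * rho t - e t)) s _).
    refine (continuous_scal_r a (fun t => k * rho t - e t) s _).
    refine (continuous_minus (fun t => k * rho t) e s _ _).
    - exact (continuous_scal_r k rho s (proj1 (hrho s Js))).
    - refine (ex_derive_continuous e s _); exists 0; now apply he. }
  (* The principal normal of g is S N, where the sign S has zero derivative. *)
  set (S := fun s => f s / Rabs (f s)).
  assert (norE : forall s, J s -> normal g s = scal (S s) (N s)).
  { intros s Js; unfold normal, normalize.
    rewrite (is_vderive_D _ _ _ (dtan s Js)), norm3_scal, (nN s Js), Rmult_1_r.
    unfold S; apply R3_ext; coords; unfold Rdiv; ring. }
  assert (dnor : forall s, J s -> is_vderive (normal g) s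
            (scal (S s) (plus (scal (- rho s) (T s))
                              (scal (e s) (cross (T s) (N s)))))).
  { intros s Js; apply (is_vderive_ext_loc (fun t => scal (S t) (N t))).
    - refine (filter_imp _ _ _ (Jo s Js)); intros t Jt; now rewrite norE.
    - pose proof (is_vderive_scal S N s _ _
        (is_derive_sign f s (cf s Js) (hf s Js))
        (proj1 (proj2 (proj2 (hfr s Js))))) as h.
      refine (is_vderive_eq _ _ _ _ h _).
      apply R3_ext; coords; ring. }
  assert (torE : forall s, J s -> torsion g s = a * (rho s + k * e s) / (w * w)).
  { intros s Js; pose proof (hfr s Js) as [o _].
    pose proof (sign_sqr (f s) (hf s Js)) as S2; fold (S s) in S2.
    unfold torsion, binormal.
    rewrite (is_vderive_D _ _ _ (dnor s Js)), tanE, norE, gE, nV by exact Js.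
    (* V x N = a (B x N) + a k (T x N) = - a T + a k B. The normal and the binormal of g each carry
       a factor S, and S^2 = 1. *)
    replace (cross (scal (/ w) (V s)) (scal (S s) (N s))) with
      (scal (S s * / w) (plus (scal (- a) (T s)) (scal (a * k) (cross (T s) (N s))))).
    - rewrite !dot_scal_l, !dot_scal_r, !dot_plus_l, !dot_plus_r,
        !dot_scal_l, !dot_scal_r.
      rewrite (dot_comm (cross _ _) (T s)), dot_cross_l, dot_cross_self by exact o.
      rewrite (proj1 o).
      transitivity (S s * S s * (a * (rho s + k * e s)) / (w * w));
        [|rewrite S2; field; lra].
      field; lra.
    - transitivity (scal (S s * / w) (plus (scal a (cross (cross (T s) (N s)) (N s)))
        (scal (a * k) (cross (T s) (N s))))).
      + rewrite cross_cross_r by exact o; apply R3_ext; coords; ring.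
      + unfold V; apply R3_ext; coords; ring. }
  set (b := fun s => plus (g s) (scal (- a) (scal (e s) (N s)))).
  assert (db : forall s, J s ->
            is_vderive b s (scal (a * e s * (rho s + k * e s)) (T s))).
  { intros s Js; destruct (hfr s Js) as [_ [_ [dN _]]].
    pose proof (is_vderive_plus _ _ _ _ _ (hg s Js)
      (is_vderive_scal_const (- a) _ _ _
        (is_vderive_scal e N s _ _ (proj1 (he s Js)) dN))) as h.
    pose proof (proj2 (he s Js)) as e2.
    refine (is_vderive_eq _ _ _ _ h _).
    (* The B-component a (1 - e^2) vanishes; writing a k as a k e^2 lets a e factor out of the
       T-component. *)
    transitivity (plus (scal (a * (1 - e s * e s)) (cross (T s) (N s)))
      (scal (a * k + a * e s * rho s) (T s)));
      [apply R3_ext; coords; ring|].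
    replace (a * e s * (rho s + k * e s))
      with (a * k * (e s * e s) + a * e s * rho s) by ring.
    rewrite e2; apply R3_ext; coords; ring. }
  assert (he0 : forall s, J s -> e s <> 0).
  { intros s Js h; destruct (he s Js) as [_ h1]; rewrite h in h1; lra. }
  assert (hS0 : forall s, J s -> S s <> 0).
  { intros s Js h; pose proof (sign_sqr (f s) (hf s Js)) as h1.
    fold (S s) in h1; rewrite h in h1; lra. }
  split.
  - split; [exact hreg|]; intros s Js; split3.
    + exact (is_vderive_vdiff _ _ _ (dtan s Js)).
    + now apply hcurv.
    + exact (is_vderive_vdiff _ _ _ (dnor s Js)).
  - exists b; split3.
    (* The N-components of [b s0] and [g s0] differ by a e, which is nonzero. *)
    + exists s0; split; [exact Js0|]; intros h.
      assert (h1 : dot (b s0) (N s0) = dot (g s0) (N s0)) by now rewrite h.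
      unfold b in h1; rewrite dot_plus_l, !dot_scal_l in h1.
      rewrite (proj1 (proj2 (proj1 (hfr s0 Js0)))) in h1.
      pose proof (Rmult_integral_contrapositive_currified a (e s0) ha (he0 s0 Js0)).
      lra.
    + exists T; split.
      * intros s Js; destruct (hfr s Js) as [o [dT _]].
        split; [exact (is_vderive_vdiff _ _ _ (db s Js))|].
        split; [exact (is_vderive_vdiff _ _ _ dT)|].
        split; [apply norm3_unit, o|].
        eexists; exact (is_vderive_D _ _ _ (db s Js)).
      * intros s Js; destruct (hfr s Js) as [o [dT _]].
        destruct (hrho s Js) as [_ hr]; pose proof (hS0 s Js) as hs.
        rewrite (is_vderive_D _ _ _ dT); split.
        { intros h; apply hr.
          assert (h1 : dot (scal (rho s) (N s)) (N s) = 0)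
            by (rewrite h; coords; ring).
          rewrite dot_scal_l, (proj1 (proj2 o)) in h1; lra. }
        intros x; rewrite norE by exact Js; unfold b; split.
        (* Both lines are directed by N, since T' = rho N and the normal of g is S N. The two
           witnesses equate N-coordinates, with b shifted from g by - a e N. *)
        { intros [r ->]; exists ((r * rho s - a * e s) / S s).
          apply R3_ext; coords; field; exact hs. }
        { intros [r ->]; exists ((r * S s + a * e s) / rho s).
          apply R3_ext; coords; field; exact hr. }
    (* If b' = 0, then rho + k e = 0 because a and e are nonzero, and this is a factor of the
       torsion of g. *)
    + intros s Js ht hb; apply ht; rewrite torE by exact Js.
      rewrite (is_vderive_D _ _ _ (db s Js)) in hb.
      assert (h1 : dot (scal (a * e s * (rho s + k * e s)) (T s)) (T s) = 0)
        by (rewrite hb; coords; ring).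
      rewrite dot_scal_l, (proj1 (proj1 (hfr s Js))), Rmult_1_r in h1.
      apply Rmult_integral in h1; destruct h1 as [h1|h1].
      * exfalso; revert h1; apply Rmult_integral_contrapositive_currified; auto.
      * rewrite h1; unfold Rdiv; ring.
Qed.

(** * Passage to the arc length of the binormal indicatrix *)

Lemma is_vderive_vint (J : R -> Prop) (g : R -> R3) (x0 x : R) :
  open_interval J -> (forall t : R, J t -> vcontinuous g t) -> J x0 -> J x ->
  is_vderive (fun t => vint g x0 t) x (g x).
Proof.
  intros hJ hg J0 Jx; split3;
    (refine (is_derive_RInt_interval J _ x0 x hJ _ J0 Jx);
     intros t Jt; destruct (hg t Jt) as [h1 [h2 h3]]; assumption).
Qed.

Theorem theorem3
  (I : R -> Prop) (al : R -> R3) (sinv : R -> R)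
  (a theta sigma0 : R) (c : R3)
  (hI : open_interval I) (hI0 : I 0)
  (hal3 : Cn_curve 3 I al)
  (hunit : unit_speed I al)
  (hkappa : forall s : R, I s -> curvature al s <> 0)
  (hB : regular_curve I (binormal al))
  (hsinv : forall s : R, I s -> sinv (binormal_arclength al s) = s)
  (htheta : sin theta <> 0)
  (hsigma0 : image (binormal_arclength al) I sigma0)
  (hreg : regular_curve (image (binormal_arclength al) I)
            (gamma_B al sinv a theta sigma0 c))
  (hcurv : forall sigma : R, image (binormal_arclength al) I sigma ->
             curvature (gamma_B al sinv a theta sigma0 c) sigma <> 0) :
  bertrand_curve (image (binormal_arclength al) I)
    (gamma_B al sinv a theta sigma0 c).
Proof.
  set (F := binormal_arclength al) in *.
  set (J := image F I) in *.
  pose proof (fun s => frenet_serret I al s (proj1 hI) hal3 hunit hkappa) as hfs.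
  set (q := fun s => norm3 (D (binormal al) s)).
  (* B' = - tau N with N a unit vector, so the indicatrix has speed |tau|; its regularity then says
     that tau never vanishes. *)
  assert (qE : forall s, I s -> q s = Rabs (torsion al s)).
  { intros s Is; destruct (hfs s Is) as [o [_ [_ [dB _]]]]; unfold q.
    rewrite (is_vderive_D _ _ _ dB), norm3_scal, Rabs_Ropp.
    rewrite (proj2 (norm3_unit _) (proj1 (proj2 o))); ring. }
  assert (tor0 : forall s, I s -> torsion al s <> 0).
  { intros s Is h; destruct (hfs s Is) as [_ [_ [_ [dB _]]]].
    apply (proj2 (hB s Is)); rewrite (is_vderive_D _ _ _ dB), h.
    apply R3_ext; coords; ring. }
  assert (torC : forall s, I s -> continuous (torsion al) s)
    by (intros s Is; apply (hfs s Is)).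
  assert (qpos : forall s, I s -> 0 < q s)
    by (intros s Is; rewrite qE by exact Is; now apply Rabs_pos_lt, tor0).
  assert (qC : forall s, I s -> continuous q s).
  { intros s Is; apply (continuous_ext_loc _ (fun t => Rabs (torsion al t))).
    - refine (filter_imp _ _ _ (proj1 hI s Is)); intros t It; symmetry; now apply qE.
    - now apply continuous_Rabs_comp, torC. }
  assert (hF : forall s, I s -> is_derive F s (q s) /\ 0 < q s).
  { intros s Is; split; [|now apply qpos].
    exact (is_derive_RInt_interval I q 0 s hI qC hI0 Is). }
  assert (hJ : open_interval J) by exact (open_interval_image I F q hI hF).
  (* [sinv] is given only as a left inverse of the arc length on I; its differentiability comes from
     the positive speed q. *)
  assert (dsinv : forall s, I s -> is_derive sinv (F s) (/ q s))
    by exact (is_derive_inverse I F q sinv hI hF hsinv).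
  set (e := fun y => torsion al (sinv y) / Rabs (torsion al (sinv y))).
  set (rho := fun y => curvature al (sinv y) * / q (sinv y)).
  (* Chain rule: differentiation in sigma is differentiation in s divided by q. *)
  assert (comp : forall (g : R -> R3) (s : R) (l : R3), I s -> is_vderive g s l ->
            is_vderive (fun y => g (sinv y)) (F s) (scal (/ q s) l)).
  { intros g s l Is hg; apply (is_vderive_comp g sinv); [|now apply dsinv].
    now rewrite hsinv. }
  assert (csinv : forall s, I s -> continuous sinv (F s)).
  { intros s Is; refine (ex_derive_continuous sinv (F s) _).
    exists (/ q s); now apply dsinv. }
  apply (bertrand_of_frame J _ (fun y => tangent al (sinv y))
    (fun y => normal al (sinv y)) rho e a (cos theta / sin theta)).
  - exact (proj1 hJ).
  - now exists sigma0.
  - intros y [s [Is ->]]; destruct (hfs s Is) as [o [dT [dN [dB _]]]].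
    (* As q = |tau|, dividing the Frenet-Serret formulae by q turns tau into the sign e and kappa
       into rho. *)
    assert (eE : e (F s) = / q s * torsion al s).
    { unfold e; rewrite hsinv, <- qE by exact Is; unfold Rdiv; ring. }
    split; [now rewrite hsinv|split3].
    + refine (is_vderive_eq _ _ _ _ (comp _ _ _ Is dT) _).
      unfold rho; rewrite hsinv by exact Is; apply R3_ext; coords; ring.
    + refine (is_vderive_eq _ _ _ _ (comp _ _ _ Is dN) _).
      rewrite eE; unfold rho, binormal; rewrite hsinv by exact Is.
      apply R3_ext; coords; ring.
    + refine (is_vderive_eq _ _ _ _ (comp _ _ _ Is dB) _).
      rewrite eE, hsinv by exact Is; apply R3_ext; coords; ring.
  - intros y [s [Is ->]]; destruct (hfs s Is) as [_ [_ [_ [_ [k0 [kC _]]]]]].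
    pose proof (qpos s Is) as q0; split.
    + refine (continuous_comp sinv (fun t => curvature al t * / q t) (F s) _ _);
        [now apply csinv|].
      rewrite hsinv by exact Is; apply continuous_Rmult; [exact kC|].
      apply continuous_Rinv_comp; [now apply qC|lra].
    + unfold rho; rewrite hsinv by exact Is.
      apply Rmult_integral_contrapositive_currified; [lra|].
      apply Rinv_neq_0_compat; lra.
  - intros y [s [Is ->]]; split.
    + refine (is_derive_eq _ _ _ _ (is_derive_comp
        (fun t => torsion al t / Rabs (torsion al t)) sinv (F s) 0 (/ q s) _ _) _).
      * rewrite hsinv by exact Is; apply is_derive_sign; auto.
      * now apply dsinv.
      * apply Rmult_0_r.
    + unfold e; rewrite hsinv by exact Is; apply sign_sqr; auto.
  (* Composites with [sinv] of curves differentiable on I are continuous on J, as the fundamental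
     theorem of calculus requires of the two integrands B and T. *)
  - assert (vc : forall g, (forall s, I s -> exists l, is_vderive g s l) ->
              forall y, J y -> vcontinuous (fun x => g (sinv x)) y).
    { intros g hg y [s [Is ->]]; destruct (hg s Is) as [l hl].
      exact (is_vderive_vcontinuous _ _ _ (comp g s l Is hl)). }
    intros y Jy; unfold gamma_B.
    refine (is_vderive_eq _ _ _ _ (is_vderive_plus _ _ _ _ _
      (is_vderive_plus _ _ _ _ _
        (is_vderive_scal_const _ _ _ _ (is_vderive_vint J _ _ _ hJ _ hsigma0 Jy))
        (is_vderive_scal_const _ _ _ _ (is_vderive_vint J _ _ _ hJ _ hsigma0 Jy)))
      (is_vderive_const c y)) _).
    + apply vc; intros s Is; destruct (hfs s Is) as [_ [_ [_ [dB _]]]].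
      eexists; exact dB.
    + apply vc; intros s Is; destruct (hfs s Is) as [_ [dT _]].
      eexists; exact dT.
    + unfold binormal; apply R3_ext; coords; ring.
  - exact hreg.
  - exact hcurv.
Qed.
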